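(* Let $A(t), B(t), C(t)$ be continuous complex $n\times n$ matrix-valued functions on $[t_0;+\infty)$ with $B(t)=B^*(t)$, $C(t)=C^*(t)$ for $t\ge t_0$, and let $[a;b]\subset[t_0;+\infty)$. Suppose that: 1) $B(t)\ge 0$ for $t\in[a;b]$; 2) there exists a continuously differentiable hermitian matrix-function $S(t)$ on $[a;b]$ such that $A^*(t)+S(t)B(t)\in\Omega_n$ for all $t\in[a;b]$; 3) with $\sigma_S(t)= W(A^*(t)+S(t)B(t))$ and $D_S(t)= S'(t)+S(t)B(t)S(t)+A^*(t)S(t)+S(t)A(t)-C(t)$, the scalar system $$\phi'=\sigma_S(t)\phi+\frac{\lambda(B(t))}{n}\psi,\qquad \psi'=-\operatorname{tr}(D_S(t))\phi-\sigma_S(t)\psi,\qquad t\in[a;b],$$ is oscillatory on $[a;b]$. Then the hamiltonian system $$\Phi'=A(t)\Phi+B(t)\Psi,\qquad \Psi'=C(t)\Phi-A^*(t)\Psi,\qquad t\ge t_0,$$ is also oscillatory on $[a;b]$.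
   Context: $M^*$ denotes the conjugate transpose of $M$. In the hamiltonian system $\Phi,\Psi$ are unknown continuously differentiable complex $n\times n$ matrix-functions on $[t_0;+\infty)$. A solution $(\Phi,\Psi)$ is called prepared if $\Phi^*(t)\Psi(t)=\Psi^*(t)\Phi(t)$ for $t\ge t_0$. A prepared solution is oscillatory on $[a;b]$ if $\det\Phi(t)$ vanishes at some point of $[a;b]$. The hamiltonian system is oscillatory on $[a;b]$ if every prepared solution is oscillatory on $[a;b]$. A real scalar linear system in unknowns $(\phi,\psi)$ is oscillatory on $[a;b]$ if for every (real) solution $(\phi,\psi)$ the function $\phi$ vanishes at some point of $[a;b]$. $\Omega_n$ is the set of normal $n\times n$ matrices $M$ ($M^*M=MM^*$) all of whose eigenvalues have the same real part; this common real part is denoted $W(M)$. For a hermitian matrix $H$, $\lambda(H)$ is its least eigenvalue, and $H\ge0$ means $H$ is non-negative definite. *)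

(* Defs.v *)
From HB Require Import structures.
From mathcomp Require Import all_boot all_order all_algebra.
From mathcomp Require Import all_classical all_reals all_analysis.
From mathcomp Require Import complex.

Set Implicit Arguments.
Unset Strict Implicit.
Unset Printing Implicit Defensive.

Import Order.TTheory GRing.Theory Num.Theory.
Import numFieldNormedType.Exports.

Local Open Scope classical_set_scope.
Local Open Scope ring_scope.
Local Open Scope complex_scope.
Local Open Scope sesquilinear_scope.

(* The library puts the modulus topology on R[i]^o, not on R[i] itself, so the
   topological notions below are stated for the convertible type
   'M[R[i]^o]_n. *)
Definition mx_continuous_on (R : realType) (n : nat) (D : set R)
    (F : R -> 'M[R[i]]_n) : Prop :=
  {within D, continuous (F : R -> 'M[R[i]^o]_n)}.

(* Derivatives are relative to D: two-sided at interior points, one-sided at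
   the endpoints of an interval. *)
Definition has_deriv_within (R : realType) (D : set R) (f : R -> R) (t l : R) :
    Prop :=
  (f s - f t) / (s - t) @[s --> within D t^'] --> l.

Definition mx_has_deriv_within (R : realType) (n : nat) (D : set R)
    (F : R -> 'M[R[i]]_n) (t : R) (L : 'M[R[i]]_n) : Prop :=
  ((s - t)^-1)%:C *: (F s - F t) @[s --> within D t^']
    --> (L : 'M[R[i]^o]_n).

Definition mx_C1_deriv (R : realType) (n : nat) (D : set R)
    (F dF : R -> 'M[R[i]]_n) : Prop :=
  (forall t, D t -> mx_has_deriv_within D F t (dF t)) /\
  mx_continuous_on D dF.

Definition nonneg_definite (R : realType) (n : nat) (H : 'M[R[i]]_n) : Prop :=
  H \is hermsymmx /\ forall v : 'cV[R[i]]_n, 0 <= (v^t* *m H *m v) 0 0.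

Definition is_least_eigenvalue (R : realType) (n : nat) (H : 'M[R[i]]_n)
    (l : R) : Prop :=
  eigenvalue H l%:C /\ forall m : R, eigenvalue H m%:C -> l <= m.

(* Meaningful for hermitian H and n > 0, where exactly one such l exists; the
   default value 0 is then never used. *)
Definition least_eigenvalue (R : realType) (n : nat) (H : 'M[R[i]]_n) : R :=
  xget 0 [set l | is_least_eigenvalue H l].

Definition eigenvalues_have_Re (R : realType) (n : nat) (M : 'M[R[i]]_n)
    (r : R) : Prop :=
  forall z : R[i], eigenvalue M z -> complex.Re z = r.

Definition Omega (R : realType) (n : nat) (M : 'M[R[i]]_n) : Prop :=
  M \is normalmx /\ exists r : R, eigenvalues_have_Re M r.

(* Meaningful for M in Omega and n > 0, where exactly one such r exists. *)
Definition W (R : realType) (n : nat) (M : 'M[R[i]]_n) : R :=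
  xget 0 [set r | eigenvalues_have_Re M r].

Definition hamiltonian_solution (R : realType) (n : nat) (t0 : R)
    (A B C Phi Psi : R -> 'M[R[i]]_n) : Prop :=
  mx_C1_deriv `[t0, +oo[ Phi (fun t => A t *m Phi t + B t *m Psi t) /\
  mx_C1_deriv `[t0, +oo[ Psi (fun t => C t *m Phi t - (A t)^t* *m Psi t).

Definition prepared (R : realType) (n : nat) (t0 : R)
    (Phi Psi : R -> 'M[R[i]]_n) : Prop :=
  forall t : R, t0 <= t -> (Phi t)^t* *m Psi t = (Psi t)^t* *m Phi t.

Definition hamiltonian_oscillatory (R : realType) (n : nat) (t0 : R)
    (A B C : R -> 'M[R[i]]_n) (a b : R) : Prop :=
  forall Phi Psi : R -> 'M[R[i]]_n,
    hamiltonian_solution t0 A B C Phi Psi -> prepared t0 Phi Psi ->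
    exists2 t : R, a <= t <= b & \det (Phi t) = 0.

(* phi' = p phi + q psi, psi' = r phi + s psi on [a; b]. *)
Definition scalar_solution (R : realType) (a b : R) (p q r s phi psi : R -> R) :
    Prop :=
  forall t : R, a <= t <= b ->
    has_deriv_within `[a, b] phi t (p t * phi t + q t * psi t) /\
    has_deriv_within `[a, b] psi t (r t * phi t + s t * psi t).

Definition scalar_oscillatory (R : realType) (a b : R) (p q r s : R -> R) :
    Prop :=
  forall phi psi : R -> R, scalar_solution a b p q r s phi psi ->
    exists2 t : R, a <= t <= b & phi t = 0.

Definition sigma_S (R : realType) (n : nat) (A B S : R -> 'M[R[i]]_n) (t : R) :
    R :=
  W ((A t)^t* + S t *m B t).

Definition D_S (R : realType) (n : nat) (A B C S dS : R -> 'M[R[i]]_n)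
    (t : R) : 'M[R[i]]_n :=
  dS t + S t *m B t *m S t + (A t)^t* *m S t + S t *m A t - C t.

(* Main.v *)
Require Import Defs.
From HB Require Import structures.
From mathcomp Require Import all_boot all_order all_algebra.
From mathcomp Require Import all_classical all_reals all_analysis.
From mathcomp Require Import complex.
From mathcomp Require Import measurable_realfun ring lra.

Set Implicit Arguments.
Unset Strict Implicit.
Unset Printing Implicit Defensive.

Import Order.TTheory GRing.Theory Num.Theory.
Import numFieldNormedType.Exports.

Local Open Scope classical_set_scope.
Local Open Scope ring_scope.
Local Open Scope complex_scope.
Local Open Scope sesquilinear_scope.

(* If det Phi had no zero on [a; b], then Z = Psi Phi^-1 - S would be hermitian
   and satisfy Z' + Z B Z + M Z + Z M^* + D_S = 0 with M = A^* + S B.  For M in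
   Omega one has M + M^* = 2 sigma I, and tr (Z B Z) >= (lambda(B)/n) (tr Z)^2,
   so z = tr Z satisfies z' + q z^2 + 2 sigma z + tr D_S = - e with
   q = lambda(B)/n and e >= 0 continuous.  To pass from this inequality to a
   non-vanishing solution of the scalar system, put
   phi0 = exp (int (sigma + q z)) and look for phi = phi0 alpha,
   psi = z phi + beta / phi0: the system becomes alpha' = (q / phi0^2) beta,
   beta' = (e phi0^2) alpha, whose coefficients are non-negative, so that its
   Picard iterates increase and alpha >= alpha(a) = 1. *)

(** * Componentwise limits of complex matrices *)

Lemma normc_lt_Re_Im (R : realType) (z : R[i]) (e : R) :
  `|z| < e%:C -> `|complex.Re z| < e /\ `|complex.Im z| < e.
Proof.
rewrite normc_def ltcR => h; split; apply: le_lt_trans h;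
  rewrite -sqrtr_sqr ler_sqrt ?addr_ge0 ?sqr_ge0 // ?lerDl ?lerDr sqr_ge0 //.
Qed.

Section ComplexMatrixLimits.
Context {R : realType} {T : Type} {G : set_system T} {FG : Filter G}.
Implicit Types (f g : T -> R[i]) (l m : R[i]).

(* Componentwise convergence only uses the topology of R, so it can be applied
   to R[i] itself, which carries none. *)
Definition ccvg f l :=
  complex.Re (f s) @[s --> G] --> complex.Re l /\
  complex.Im (f s) @[s --> G] --> complex.Im l.

Definition mxcvg p q (F : T -> 'M[R[i]]_(p, q)) (L : 'M[R[i]]_(p, q)) :=
  forall i j, ccvg (fun s => F s i j) (L i j).

Lemma ccvg_cst l : ccvg (fun=> l) l.
Proof. by split; exact: cvg_cst. Qed.

Lemma near_ccvg f g l : (\forall s \near G, f s = g s) -> ccvg f l -> ccvg g l.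
Proof.
move=> fg [fRe fIm]; split.
  apply: cvg_trans fRe; apply: near_eq_cvg.
  by apply: filterS fg => s ->.
apply: cvg_trans fIm; apply: near_eq_cvg.
by apply: filterS fg => s ->.
Qed.

Lemma ccvgD f g l m : ccvg f l -> ccvg g m -> ccvg (fun s => f s + g s) (l + m).
Proof.
case: l m => [l1 l2] [m1 m2] [fRe fIm] [gRe gIm]; split => /=.
  under eq_fun do rewrite raddfD.
  exact: cvgD.
under eq_fun do rewrite raddfD.
exact: cvgD.
Qed.

Lemma ccvgN f l : ccvg f l -> ccvg (fun s => - f s) (- l).
Proof.
case: l => [l1 l2] [fRe fIm]; split => /=.
  under eq_fun do rewrite raddfN.
  exact: cvgN.
under eq_fun do rewrite raddfN.
exact: cvgN.
Qed.

Lemma ccvg_conj f l : ccvg f l -> ccvg (fun s => (f s)^*) (l^*).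
Proof.
case: l => [l1 l2] [fRe fIm]; split => /=.
  have -> : (fun s => complex.Re (f s)^*) = (fun s => complex.Re (f s)).
    by apply/funext => s; case: (f s).
  exact: fRe.
have -> : (fun s => complex.Im (f s)^*) = (fun s => - complex.Im (f s)).
  by apply/funext => s; case: (f s).
exact: cvgN.
Qed.

Lemma ccvgM f g l m : ccvg f l -> ccvg g m -> ccvg (fun s => f s * g s) (l * m).
Proof.
case: l m => [l1 l2] [m1 m2] [fRe fIm] [gRe gIm]; split => /=.
  have -> : (fun s => complex.Re (f s * g s)) = (fun s =>
    complex.Re (f s) * complex.Re (g s) - complex.Im (f s) * complex.Im (g s)).
    by apply/funext => s; case: (f s) (g s) => ? ? [].
  by apply: cvgB; apply: cvgM.
have -> : (fun s => complex.Im (f s * g s)) = (fun s =>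
  complex.Re (f s) * complex.Im (g s) + complex.Im (f s) * complex.Re (g s)).
  by apply/funext => s; case: (f s) (g s) => ? ? [].
by apply: cvgD; apply: cvgM.
Qed.

(** The components of the inverse of z are Re z and - Im z divided by the squared modulus, and the
    squared modulus has a nonzero limit. *)
Lemma ccvgV f l : l != 0 -> ccvg f l -> ccvg (fun s => (f s)^-1) l^-1.
Proof.
case: l => [l1 l2] l0 [fRe fIm].
have n0 : l1 ^+ 2 + l2 ^+ 2 != 0.
  rewrite paddr_eq0 ?sqr_ge0 // !sqrf_eq0; apply: contra l0.
  by move=> /andP[/eqP -> /eqP ->].
have cn : (complex.Re (f s) ^+ 2 + complex.Im (f s) ^+ 2)^-1 @[s --> G] -->
    (l1 ^+ 2 + l2 ^+ 2)^-1.
  by apply: cvgV => //; apply: cvgD; apply: cvgM.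
split => /=.
  have -> : (fun s => complex.Re (f s)^-1) = (fun s => complex.Re (f s) *
     (complex.Re (f s) ^+ 2 + complex.Im (f s) ^+ 2)^-1).
    by apply/funext => s; case: (f s).
  exact: cvgM.
have -> : (fun s => complex.Im (f s)^-1) = (fun s => - (complex.Im (f s) *
     (complex.Re (f s) ^+ 2 + complex.Im (f s) ^+ 2)^-1)).
  by apply/funext => s; case: (f s).
by apply: cvgN; apply: cvgM.
Qed.

Lemma ccvg_sum (I : Type) (r : seq I) (P : pred I) (f : I -> T -> R[i])
    (l : I -> R[i]) :
  (forall i, ccvg (f i) (l i)) ->
  ccvg (fun s => \sum_(i <- r | P i) f i s) (\sum_(i <- r | P i) l i).
Proof.
move=> fl; elim: r => [|i r IH].
  by rewrite big_nil; under eq_fun do rewrite big_nil; exact: ccvg_cst.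
rewrite big_cons; under eq_fun do rewrite big_cons.
by case: (P i) => //; apply: ccvgD.
Qed.

Lemma ccvg_prod (I : Type) (r : seq I) (P : pred I) (f : I -> T -> R[i])
    (l : I -> R[i]) :
  (forall i, ccvg (f i) (l i)) ->
  ccvg (fun s => \prod_(i <- r | P i) f i s) (\prod_(i <- r | P i) l i).
Proof.
move=> fl; elim: r => [|i r IH].
  by rewrite big_nil; under eq_fun do rewrite big_nil; exact: ccvg_cst.
rewrite big_cons; under eq_fun do rewrite big_cons.
by case: (P i) => //; apply: ccvgM.
Qed.

Lemma mxcvg_cst p q (L : 'M[R[i]]_(p, q)) : mxcvg (fun=> L) L.
Proof. by move=> i j; exact: ccvg_cst. Qed.

Lemma near_mxcvg p q (F H : T -> 'M[R[i]]_(p, q)) L :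
  (\forall s \near G, F s = H s) -> mxcvg F L -> mxcvg H L.
Proof.
move=> FH FL i j; apply: near_ccvg (FL i j).
by apply: filterS FH => s ->.
Qed.

Lemma mxcvgD p q (F H : T -> 'M[R[i]]_(p, q)) L M :
  mxcvg F L -> mxcvg H M -> mxcvg (fun s => F s + H s) (L + M).
Proof.
move=> FL HM i j; rewrite mxE; under eq_fun do rewrite mxE.
exact: ccvgD.
Qed.

Lemma mxcvgN p q (F : T -> 'M[R[i]]_(p, q)) L :
  mxcvg F L -> mxcvg (fun s => - F s) (- L).
Proof.
move=> FL i j; rewrite mxE; under eq_fun do rewrite mxE.
exact: ccvgN.
Qed.

Lemma mxcvgB p q (F H : T -> 'M[R[i]]_(p, q)) L M :
  mxcvg F L -> mxcvg H M -> mxcvg (fun s => F s - H s) (L - M).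
Proof. by move=> FL HM; apply: mxcvgD => //; exact: mxcvgN. Qed.

Lemma mxcvgM p q r (F : T -> 'M[R[i]]_(p, q)) (H : T -> 'M[R[i]]_(q, r)) L M :
  mxcvg F L -> mxcvg H M -> mxcvg (fun s => F s *m H s) (L *m M).
Proof.
move=> FL HM i j; rewrite mxE; under eq_fun do rewrite mxE.
by apply: ccvg_sum => k; exact: ccvgM.
Qed.

Lemma mxcvg_conj p q (F : T -> 'M[R[i]]_(p, q)) L :
  mxcvg F L -> mxcvg (fun s => (F s)^t*) (L^t*).
Proof.
move=> FL i j; rewrite !mxE; under eq_fun do rewrite !mxE.
exact: ccvg_conj.
Qed.

Lemma ccvg_tr p (F : T -> 'M[R[i]]_p) L :
  mxcvg F L -> ccvg (fun s => \tr (F s)) (\tr L).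
Proof. by move=> FL; apply: ccvg_sum => i. Qed.

Lemma ccvg_det p (F : T -> 'M[R[i]]_p) L :
  mxcvg F L -> ccvg (fun s => \det (F s)) (\det L).
Proof.
move=> FL; apply: ccvg_sum => s; apply: ccvgM; first exact: ccvg_cst.
exact: ccvg_prod.
Qed.

Lemma mxcvgZ p q f l (F : T -> 'M[R[i]]_(p, q)) L :
  ccvg f l -> mxcvg F L -> mxcvg (fun s => f s *: F s) (l *: L).
Proof.
move=> fl FL i j; rewrite mxE; under eq_fun do rewrite mxE.
exact: ccvgM.
Qed.

Lemma mxcvg_adj p (F : T -> 'M[R[i]]_p) L :
  mxcvg F L -> mxcvg (fun s => \adj (F s)) (\adj L).
Proof.
move=> FL i j; rewrite mxE; under eq_fun do rewrite mxE.
apply: ccvgM; first exact: ccvg_cst.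
apply: ccvg_det => k l; rewrite 2!mxE.
by under eq_fun do rewrite 2!mxE.
Qed.

Lemma mxcvgV p (F : T -> 'M[R[i]]_p) L :
  L \in unitmx -> (\forall s \near G, F s \in unitmx) ->
  mxcvg F L -> mxcvg (fun s => invmx (F s)) (invmx L).
Proof.
move=> uL uF FL.
have dL : \det L != 0 by rewrite -unitfE -unitmxE.
apply: (@near_mxcvg _ _ (fun s => (\det (F s))^-1 *: \adj (F s))).
  by apply: filterS uF => s uFs; rewrite /invmx uFs.
rewrite /invmx uL; apply: mxcvgZ; first by apply: ccvgV => //; exact: ccvg_det.
exact: mxcvg_adj.
Qed.

(** The bridge from the matrix topology of the definitions to components: a matrix ball of radius
    [e%:C] controls the modulus of every entry, hence its real and imaginary parts. *)
Lemma cvg_mxcvg p (F : T -> 'M[R[i]]_p) (L : 'M[R[i]]_p) :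
  F s @[s --> G] --> (L : 'M[R[i]^o]_p) -> mxcvg F L.
Proof.
move=> FL i j.
have H (e : R) : 0 < e -> \forall s \near G, `|L i j - F s i j| < e%:C.
  move=> e0.
  have e0' : (0 < e%:C :> R[i]) by rewrite ltcR.
  have B : nbhs (L : 'M[R[i]^o]_p) (ball (L : 'M[R[i]^o]_p) e%:C).
    exact: (@nbhsx_ballx _ _ (L : 'M[R[i]^o]_p) e%:C e0').
  have GB := FL _ B.
  have {}GB : G (F @^-1` (ball (L : 'M[R[i]^o]_p) e%:C)) by exact: GB.
  by apply: (@filterS _ G FG _ _ _ GB) => s [_ /(_ i j)].
have H2 (e : R) : 0 < e -> \forall s \near G,
    `|complex.Re (L i j) - complex.Re (F s i j)| < e /\
    `|complex.Im (L i j) - complex.Im (F s i j)| < e.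
  move=> /H; apply: filterS => s h.
  by have := normc_lt_Re_Im h; rewrite !raddfB.
by split; apply/cvgrPdist_lt => e /H2; apply: filterS => s [].
Qed.

End ComplexMatrixLimits.
Arguments ccvg {R T} G f l.
Arguments mxcvg {R T} G {p q} F L.

(** * One-sided derivatives and integrals on a segment *)

Section DerivWithin.
Context {R : realType}.
Implicit Types (D : set R) (f g : R -> R) (t l m : R).

Lemma eq_has_deriv_within D f g t l : (forall s, D s -> f s = g s) -> D t ->
  has_deriv_within D f t l -> has_deriv_within D g t l.
Proof.
move=> fg Dt; rewrite /has_deriv_within; apply: cvg_trans; apply: near_eq_cvg.
by near=> s; rewrite !fg //; near: s; exact: near_withinT.
Unshelve. all: by end_near. Qed.

Lemma has_deriv_within_cvg D f t l : has_deriv_within D f t l ->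
  f s @[s --> within D t^'] --> f t.
Proof.
move=> fl.
have st : s - t @[s --> within D t^'] --> (0 : R).
  rewrite -(subrr t); apply: cvgB; last exact: cvg_cst.
  by apply: cvg_within_filter; apply: cvg_within_filter; exact: cvg_id.
have : f t + (f s - f t) / (s - t) * (s - t) @[s --> within D t^'] -->
    f t + l * 0 by apply: cvgD; [exact: cvg_cst|exact: cvgM].
rewrite mulr0 addr0; apply: cvg_trans; apply: near_eq_cvg.
near=> s => /=.
have ts : s - t != 0.
  rewrite subr_eq0; near: s; apply: (@cvg_within _ t^' _ D).
  exact: (@near_withinT _ (nbhs t)).
by rewrite divfK // addrC subrK.
Unshelve. all: by end_near. Qed.

Lemma cvg_dnbhs_nbhs D f t : f s @[s --> within D t^'] --> f t ->
  f s @[s --> within D (nbhs t)] --> f t.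
Proof.
move=> /cvgrPdist_lt ft; apply/cvgrPdist_lt => e e0.
have h : \forall s \near t, s != t -> D s -> `|f t - f s| < e := ft e e0.
rewrite near_withinE; apply: filterS h => s h Ds.
by have [->|st] := eqVneq s t; [rewrite subrr normr0|exact: h].
Qed.

Lemma has_deriv_withinD D f g t l m :
  has_deriv_within D f t l -> has_deriv_within D g t m ->
  has_deriv_within D (fun s => f s + g s) t (l + m).
Proof.
move=> fl gm; rewrite /has_deriv_within.
have -> : (fun s => (f s + g s - (f t + g t)) / (s - t)) =
  (fun s => (f s - f t) / (s - t) + (g s - g t) / (s - t)).
  by apply/funext => s; rewrite -mulrDl opprD addrACA.
exact: cvgD.
Qed.

Lemma has_deriv_withinM D f g t l m :
  has_deriv_within D f t l -> has_deriv_within D g t m ->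
  has_deriv_within D (fun s => f s * g s) t (l * g t + f t * m).
Proof.
move=> fl gm; rewrite /has_deriv_within.
have -> : (fun s => (f s * g s - (f t * g t)) / (s - t)) =
  (fun s => (f s - f t) / (s - t) * g t + f s * ((g s - g t) / (s - t))).
  by apply/funext => s; rewrite mulrAC mulrA -mulrDl; congr (_ * _); ring.
apply: cvgD; first by apply: cvgM => //; exact: cvg_cst.
by apply: cvgM => //; exact: has_deriv_within_cvg fl.
Qed.

Lemma is_derive_has_deriv_within D f t l :
  is_derive t (1 : R) f l -> has_deriv_within D f t l.
Proof.
move=> [df dfl].
have H : h^-1 * (f (h + t) - f t) @[h --> (0 : R)^'] --> l.
  rewrite -dfl; suff -> : (fun h : R => h^-1 * (f (h + t) - f t)) =
    (fun h => h^-1 *: ((f \o shift t) (h *: (1 : R)) - f t)) by exact: df.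
  by apply/funext => h; rewrite /= /GRing.scale /= mulr1.
(* The substitution h = s - t carries punctured neighbourhoods of t to punctured neighbourhoods of
   0. *)
have st : s - t @[s --> t^'] --> (0 : R)^'.
  have st : s - t @[s --> t] --> (0 : R).
    by rewrite -(subrr t); apply: cvgB; [exact: cvg_id|exact: cvg_cst].
  move=> P P0; have {}P0 : \forall h \near (0 : R), h != 0 -> P h := P0.
  suff : \forall s \near t, s != t -> P (s - t) by [].
  have {}P0 : \forall s \near t, s - t != 0 -> P (s - t) := st _ P0.
  by apply: filterS P0 => s Ps st'; apply: Ps; rewrite subr_eq0.
have h := cvg_comp _ _ st H.
apply: cvg_within_filter; apply: cvg_trans h; apply: near_eq_cvg.
by apply: nearW => s /=; rewrite subrK mulrC.
Qed.

Lemma has_deriv_within_cst D (c t : R) : has_deriv_within D (fun=> c) t 0.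
Proof.
exact: (@is_derive_has_deriv_within D (cst c) t 0 (is_derive_cst c t (1 : R))).
Qed.

End DerivWithin.

(** * Integrals with a clamped upper limit *)

Section ClampedIntegral.
Context {R : realType}.
Variables (a b : R) (ab : a < b).
Notation mu := (@lebesgue_measure R).
Implicit Types (f g : R -> R) (x t : R).

(* Composing with clamp turns functions continuous on [a, b] into functions
   continuous on the whole line. *)
Definition clamp x := Num.max a (Num.min x b).

Lemma clamp_itv x : a <= clamp x <= b.
Proof. by rewrite le_max lexx /= ge_max (ltW ab) ge_min lexx orbT. Qed.

Lemma clamp_id x : a <= x <= b -> clamp x = x.
Proof. by case/andP => ax xb; rewrite /clamp (min_idPl xb) (max_idPr ax). Qed.

Lemma clamp_continuous : continuous clamp.
Proof.
move=> x; apply: (@continuous_max _ _ (fun=> a) (fun x => Num.min x b)).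
  exact: cvg_cst.
apply: (@continuous_min _ _ id (fun=> b)); first exact: cvg_id.
exact: cvg_cst.
Qed.

Lemma clamp_extension f :
  (forall t, a <= t <= b -> f s @[s --> within `[a, b] (nbhs t)] --> f t) ->
  continuous (f \o clamp).
Proof.
move=> fc x.
apply: cvg_comp (fc _ (clamp_itv x)).
move=> P Pc.
have h : \forall y \near x, `[a, b]%classic (clamp y) -> P (clamp y).
  exact: (@clamp_continuous x (fun y => `[a, b]%classic y -> P y) Pc).
suff h' : \forall y \near x, P (clamp y) by [].
by apply: filterS h => y; apply; rewrite /= in_itv /= clamp_itv.
Qed.

Lemma continuous_integrable f c d : continuous f ->
  mu.-integrable `[c, d] (EFin \o f).
Proof.
move=> fc; apply: continuous_compact_integrable; first exact: segment_compact.
exact: continuous_subspaceT.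
Qed.

(** Clamping the upper limit gives a function on the whole line, constant outside [[a, b]], to which
    integration can be applied again. *)
Definition clamped_integral f x := \int[mu]_(t in `[a, clamp x]) f t.
Local Notation J := clamped_integral.

Lemma integrable_clamp f x : mu.-integrable `[a, b] (EFin \o f) ->
  mu.-integrable `[a, clamp x] (EFin \o f).
Proof.
apply: integrableS => //; apply: subset_itvl.
by rewrite bnd_simp; case/andP: (clamp_itv x).
Qed.

Lemma clamped_integral_continuous f :
  mu.-integrable `[a, b] (EFin \o f) -> continuous (J f).
Proof.
move=> /(parameterized_integral_continuous (ltW ab)) /subspace_continuousP h.
apply: (@clamp_extension (fun x => \int[mu]_(t in `[a, x]) f t)) => t tab.
by apply: h; rewrite /= in_itv.
Qed.

Lemma le_clamped_integral f g x : mu.-integrable `[a, b] (EFin \o f) ->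
  mu.-integrable `[a, b] (EFin \o g) ->
  (forall t, a <= t <= b -> f t <= g t) -> J f x <= J g x.
Proof.
move=> fi gi fg; apply: le_Rintegral => //; try exact: integrable_clamp.
move=> t; rewrite /= in_itv /= => /andP[at_ tx]; apply: fg; rewrite at_ /=.
by apply: le_trans tx _; case/andP: (clamp_itv x).
Qed.

Lemma clamped_integral_ge0 f x : (forall t, 0 <= f t) -> 0 <= J f x.
Proof. by move=> f0; apply: Rintegral_ge0. Qed.

Lemma clamped_integral_deriv f t : continuous f -> a <= t <= b ->
  has_deriv_within `[a, b] (J f) t (f t).
Proof.
move=> fc tab; have ci c d := @continuous_integrable f c d fc.
(* Starting the integral at [a - 1] makes every point of [[a, b]], the endpoints included, interior
   to the interval where the fundamental theorem is applied. The additive constant [F a] is removed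
   afterwards. *)
pose F x := \int[mu]_(t in `[a - 1, x]) f t.
have FJ x : a <= x <= b -> F x - F a = J f x.
  move=> /[dup] xab /andP[ax xb].
  rewrite /F (@Rintegral_itvB _ f (BLeft (a - 1)) (BRight x) a) ?bnd_simp //.
    rewrite Rintegral_itv_obnd_cbnd /J ?clamp_id //.
    by apply: integrableS (ci a x) => //; apply: subset_itvr; rewrite bnd_simp.
  by rewrite gerBl.
have dF : has_deriv_within `[a, b] F t (f t).
  apply: is_derive_has_deriv_within.
  have [|||dF Fe] := @continuous_FTC1_closed R f (a - 1) t (t + 1) _ (ci _ _).
  - by rewrite ltrDl.
  - by case/andP: tab => at_ _; rewrite ltrBlDr (le_lt_trans at_) // ltrDl.
  - exact: fc.
  by split; [exact: dF|rewrite -Fe derive1E].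
have h := has_deriv_withinD dF (has_deriv_within_cst `[a, b] (- F a) t).
rewrite addr0 in h; apply: eq_has_deriv_within h; last by rewrite /= in_itv.
by move=> s; rewrite /= in_itv /= => sab; rewrite -FJ.
Qed.

(** This is the integral equation G = 1 + int K G of the exponential that will dominate the Picard
    iterates. *)
Lemma clamped_integral_exp K x :
  J (fun t => K * expR (K * (t - a))) x = expR (K * (clamp x - a)) - 1.
Proof.
pose F t := expR (K * (t - a)).
have dF t : is_derive t (1 : R) F (K * expR (K * (t - a))).
  have d1 : is_derive t (1 : R) (fun t => K * (t - a)) K.
    have := is_deriveZ K (is_deriveB (is_derive_id t (1 : R)) (is_derive_cst a t 1)).
    by rewrite subr0 /GRing.scale /= mulr1.
  rewrite mulrC.
  exact: (@is_derive1_comp R expR (fun t => K * (t - a)) t _ _ (is_derive_expR _) d1).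
have cF : continuous F.
  move=> t; apply: differentiable_continuous; apply/derivable1_diffP.
  by have [] := dF t.
(* The fundamental theorem is applied on a nondegenerate interval, so the case [clamp x = a] is
   settled separately. *)
have /andP[] := clamp_itv x; rewrite le_eqVlt => /predU1P[ac _|ac _].
  by rewrite /J -ac set_itv1 Rintegral_set1 subrr mulr0 expR0 subrr.
rewrite /J /Rintegral (@continuous_FTC2 R _ F a (clamp x) ac).
- by rewrite /= /F subrr mulr0 expR0.
- apply: continuous_subspaceT => t; apply: cvgM; first exact: cvg_cst.
  exact: cF.
- split; first by move=> t _; have [] := dF t.
  + exact/cvg_at_right_filter/cF.
  + exact/cvg_at_left_filter/cF.
- by move=> t _; rewrite derive1E; have [] := dF t.
Qed.

(** Dominated convergence with the constant [M] as dominating function. Only pointwise convergence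
    is available for the Picard iterates, so the limit [g] comes out integrable; its continuity has
    to be recovered later. *)
Lemma integral_cvg (f : nat -> R -> R) g (M c d : R) :
  (forall k, continuous (f k)) -> (forall k t, `|f k t| <= M) ->
  (forall t, f k t @[k --> \oo] --> g t) ->
  mu.-integrable `[c, d] (EFin \o g) /\
  \int[mu]_(t in `[c, d]) f k t @[k --> \oo] --> \int[mu]_(t in `[c, d]) g t.
Proof.
move=> fc fM fg.
have cv t : (f k t)%:E @[k --> \oo] --> (g t)%:E.
  by apply: cvg_EFin; [exact: nearW|exact: fg].
have mf k : (@measurable_fun _ _ (measurableTypeR R) _ `[c, d] (EFin \o f k)).
  by have /integrableP[] := @continuous_integrable (f k) c d (fc k).
have mg := emeasurable_fun_cvg _ _ mf (fun t _ => cv t).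
have [||||||gi _ cvi] := @dominated_convergence _ _ R mu `[c, d] _
  (fun k => EFin \o f k) (EFin \o g) (cst M%:E).
- by [].
- exact: mf.
- exact: mg.
- by apply: aeW => t _; exact: cv.
- apply: continuous_integrable; exact: cst_continuous.
- by apply: aeW => t k _; rewrite lee_fin.
split=> //; apply: fine_cvg.
by rewrite fineK; [exact: cvi|exact: integrable_fin_num].
Qed.

End ClampedIntegral.

(** * The scalar system *)

Section PositiveSystem.
Context {R : realType}.
Variables (a b : R) (ab : a < b) (Q E : R -> R) (K : R).
Hypotheses (cQ : continuous Q) (cE : continuous E).
Hypotheses (Q0 : forall t, 0 <= Q t) (E0 : forall t, 0 <= E t).
Hypotheses (QK : forall t, Q t <= K) (EK : forall t, E t <= K).
Notation mu := (@lebesgue_measure R).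
Local Notation J := (clamped_integral a b).

(** Iterates for the integral equations alpha = 1 + int Q beta, beta = int E alpha. Starting from
    (0, 0) reduces the first case of monotonicity to non-negativity. *)
Fixpoint picard k : (R -> R) * (R -> R) :=
  if k is k'.+1 then
    (fun t => 1 + J (fun s => Q s * (picard k').2 s) t,
     J (fun s => E s * (picard k').1 s))
  else (fun=> 0, fun=> 0).

(* G solves G' = K G with G a = 1, hence dominates every iterate. *)
Let G t := expR (K * (clamp a b t - a)).

Let K0 : 0 <= K. Proof. exact: le_trans (Q0 0) (QK 0). Qed.

Lemma picard_continuous k :
  continuous (picard k).1 /\ continuous (picard k).2.
Proof.
elim: k => [|k [IH1 IH2]] /=; first by split; exact: cst_continuous.
have iM (f g : R -> R) : continuous f -> continuous g ->
    continuous (J (fun s => f s * g s)).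
  move=> cf cg; apply: clamped_integral_continuous => //; apply: continuous_integrable.
  by move=> t; apply: cvgM; [exact: cf|exact: cg].
split=> [t|]; last exact: iM.
by apply: cvgD; [exact: cvg_cst|exact: iM].
Qed.

Let picard_integrable k :
  mu.-integrable `[a, b] (EFin \o (fun s => Q s * (picard k).2 s)) /\
  mu.-integrable `[a, b] (EFin \o (fun s => E s * (picard k).1 s)).
Proof.
have [cf cg] := picard_continuous k.
by split; apply: continuous_integrable => t; apply: cvgM;
  [exact: cQ|exact: cg|exact: cE|exact: cf].
Qed.

(** If an iterate is at most [G] and its coefficient at most [K], the next integral is at most int K
    G = G - 1, which leaves room for the added constant 1. *)
Lemma picard_bound k t :
  (0 <= (picard k).1 t <= G t) /\ (0 <= (picard k).2 t <= G t).
Proof.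
elim: k t => [|k IH] t /=; first by rewrite lexx expR_ge0.
have [iQ iE] := picard_integrable k.
have iK : mu.-integrable `[a, b] (EFin \o (fun t => K * expR (K * (t - a)))).
  apply: continuous_integrable => s; apply: cvgM; first exact: cvg_cst.
  apply: continuous_comp; last exact: continuous_expR.
  apply: cvgM; first exact: cvg_cst.
  by apply: cvgB; [exact: cvg_id|exact: cvg_cst].
have bnd (h1 h2 : R -> R) : (forall s, 0 <= h1 s <= K) ->
    (forall s, 0 <= h2 s <= G s) ->
    mu.-integrable `[a, b] (EFin \o (fun s => h1 s * h2 s)) ->
    0 <= J (fun s => h1 s * h2 s) t <= G t - 1.
  move=> h1K h2G ih; apply/andP; split.
    apply: clamped_integral_ge0 => s.
    case/andP: (h1K s) => ? _; case/andP: (h2G s) => ? _.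
    exact: mulr_ge0.
  rewrite /G -clamped_integral_exp //; apply: le_clamped_integral => // s sab.
  case/andP: (h1K s) => ? ?; case/andP: (h2G s); rewrite /G clamp_id // => ? ?.
  exact: ler_pM.
have /andP[b1 b2] : 0 <= J (fun s => Q s * (picard k).2 s) t <= G t - 1.
  by apply: bnd => // s; [rewrite Q0 QK|have [] := IH s].
have /andP[b3 b4] : 0 <= J (fun s => E s * (picard k).1 s) t <= G t - 1.
  by apply: bnd => // s; [rewrite E0 EK|have [] := IH s].
by split; lra.
Qed.

(** Non-negative coefficients make the integral operator monotone, so an inequality between
    consecutive iterates is passed on. *)
Lemma picard_nondecreasing k t :
  (picard k).1 t <= (picard k.+1).1 t /\ (picard k).2 t <= (picard k.+1).2 t.
Proof.
elim: k t => [|k IH] t.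
  have [/andP[h1 _] /andP[h2 _]] := picard_bound 1 t; by split.
have [iQ iE] := picard_integrable k; have [iQ1 iE1] := picard_integrable k.+1.
have hE : J (fun s => E s * (picard k).1 s) t <=
    J (fun s => E s * (picard k.+1).1 s) t.
  by apply: le_clamped_integral => // s _; apply: ler_wpM2l => //; have [] := IH s.
have hQ : J (fun s => Q s * (picard k).2 s) t <=
    J (fun s => Q s * (picard k.+1).2 s) t.
  by apply: le_clamped_integral => // s _; apply: ler_wpM2l => //; have [] := IH s.
by split; [rewrite lerD2l|].
Qed.

(** The iterates increase and are bounded, hence converge pointwise; dominated convergence carries
    the limits into the integral equations. The bound [1 <= alpha] holds because the integral added
    to 1 has a non-negative integrand. *)
Lemma positive_system : exists alpha beta : R -> R,
  [/\ continuous alpha, continuous beta & forall t, a <= t <= b ->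
  [/\ has_deriv_within `[a, b] alpha t (Q t * beta t),
      has_deriv_within `[a, b] beta t (E t * alpha t) & 1 <= alpha t]].
Proof.
pose M := expR (K * (b - a)).
(* [M] is the value of [G] at [b]: a bound uniform in t, as dominated convergence requires. *)
have GM t : G t <= M.
  rewrite ler_expR ler_wpM2l // lerB //; by case/andP: (clamp_itv ab t).
pose al t := limn (fun k => (picard k).1 t).
pose be t := limn (fun k => (picard k).2 t).
have cal t : (picard k).1 t @[k --> \oo] --> al t.
  apply: nondecreasing_is_cvgn.
    by apply/nondecreasing_seqP => k; have [] := picard_nondecreasing k t.
  exists M => _ [k _ <-]; have [/andP[_ h] _] := picard_bound k t.
  exact: le_trans (GM t).
have cbe t : (picard k).2 t @[k --> \oo] --> be t.
  apply: nondecreasing_is_cvgn.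
    by apply/nondecreasing_seqP => k; have [] := picard_nondecreasing k t.
  exists M => _ [k _ <-]; have [_ /andP[_ h]] := picard_bound k t.
  exact: le_trans (GM t).
have lim (q : R -> R) (f : nat -> R -> R) g : continuous q ->
    (forall t, 0 <= q t <= K) -> (forall k, continuous (f k)) ->
    (forall k t, 0 <= f k t <= M) -> (forall t, f k t @[k --> \oo] --> g t) ->
    continuous (J (fun s => q s * g s)) /\
    forall t, J (fun s => q s * f k s) t @[k --> \oo] -->
      J (fun s => q s * g s) t.
  move=> cq qK cf fM fg.
  have h c d : mu.-integrable `[c, d] (EFin \o (fun s => q s * g s)) /\
      \int[mu]_(t in `[c, d]) (q t * f k t) @[k --> \oo] -->
      \int[mu]_(t in `[c, d]) (q t * g t).
    apply: (@integral_cvg _ (fun k t => q t * f k t) _ (K * M)).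
    - by move=> k t; apply: cvgM; [exact: cq|exact: cf].
    - move=> k t; case/andP: (qK t) => ? ?; case/andP: (fM k t) => ? ?.
      by rewrite ger0_norm ?mulr_ge0 // ler_pM.
    - by move=> t; apply: cvgM; [exact: cvg_cst|exact: fg].
  split; first by apply: clamped_integral_continuous => //; have [] := h a b.
  by move=> t; have [] := h a (clamp a b t).
have picM k t : (0 <= (picard k).1 t <= M) /\ (0 <= (picard k).2 t <= M).
  have [/andP[-> h1] /andP[-> h2]] := picard_bound k t.
  by rewrite !(le_trans _ (GM t)).
have [cJbe Jbe] := lim Q (fun k => (picard k).2) be cQ
  (fun t => introT andP (conj (Q0 t) (QK t))) (fun k => proj2 (picard_continuous k))
  (fun k t => proj2 (picM k t)) cbe.
have [cJal Jal] := lim E (fun k => (picard k).1) al cE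
  (fun t => introT andP (conj (E0 t) (EK t))) (fun k => proj1 (picard_continuous k))
  (fun k t => proj1 (picM k t)) cal.
have alE t : al t = 1 + J (fun s => Q s * be s) t.
  have h1 := cal t; rewrite -cvg_shiftS /= in h1.
  have h2 : 1 + J (fun s => Q s * (picard k).2 s) t @[k --> \oo] -->
    1 + J (fun s => Q s * be s) t by apply: cvgD; [exact: cvg_cst|exact: Jbe].
  exact: (cvg_unique _ h1 h2).
have beE t : be t = J (fun s => E s * al s) t.
  have h1 := cbe t; rewrite -cvg_shiftS /= in h1.
  exact: (cvg_unique _ h1 (Jal t)).
(* Bootstrap: the integral of a merely integrable function is continuous in its endpoint, so the
   integral equations make the limits continuous, after which the fundamental theorem differentiates
   them. *)
have cal' : continuous al.
  rewrite (_ : al = (fun t => 1 + J (fun s => Q s * be s) t)); last exact/funext.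
  by move=> t; apply: cvgD; [exact: cvg_cst|exact: cJbe].
have cbe' : continuous be.
  by rewrite (_ : be = J (fun s => E s * al s)); last exact/funext.
exists al, be; split=> // t tab; split.
- rewrite (_ : al = (fun t => 1 + J (fun s => Q s * be s) t)); last exact/funext.
  rewrite -[X in has_deriv_within _ _ _ X]add0r.
  apply: has_deriv_withinD; first exact: has_deriv_within_cst.
  apply: (@clamped_integral_deriv _ _ _ (fun s => Q s * be s)) => // s.
  by apply: cvgM; [exact: cQ|exact: cbe'].
- rewrite (_ : be = J (fun s => E s * al s)); last exact/funext.
  apply: (@clamped_integral_deriv _ _ _ (fun s => E s * al s)) => // s.
  by apply: cvgM; [exact: cE|exact: cal'].
- rewrite alE lerDl; apply: clamped_integral_ge0 => s; apply: mulr_ge0 => //.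
  rewrite beE; apply: clamped_integral_ge0 => r; apply: mulr_ge0 => //.
  apply: limr_ge; first exact: cvgP (cal r).
  apply: nearW => k.
  by have [/andP[]] := picard_bound k r.
Qed.

End PositiveSystem.

(** * Scalar Riccati equation with a non-negative defect *)

Lemma has_deriv_within_comp (R : realType) (D : set R) (f g : R -> R) (t l m : R) :
  is_derive (f t) (1 : R) g m -> has_deriv_within D f t l ->
  has_deriv_within D (g \o f) t (m * l).
Proof.
move=> gm fl.
(* The difference quotient of [g], completed by its limit at [f t]. It makes the factorisation of
   the quotient of the composite valid even where [f s = f t]. *)
pose h u := if u == f t then m else (g u - g (f t)) / (u - f t).
have hm : h u @[u --> f t] --> h (f t).
  suff : h u @[u --> within setT (nbhs (f t))] --> h (f t) by rewrite withinET.
  apply: cvg_dnbhs_nbhs; rewrite {2}/h eqxx.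
  have := is_derive_has_deriv_within setT gm; rewrite /has_deriv_within.
  rewrite !withinET; apply: cvg_trans; apply: near_eq_cvg.
  near=> u; rewrite /h ifF //; apply/negbTE; near: u.
  exact: (@near_withinT _ (nbhs (f t))).
have hf : h (f s) @[s --> within D t^'] --> m.
  by have := cvg_comp _ _ (has_deriv_within_cvg fl) hm; rewrite {2}/h eqxx.
rewrite /has_deriv_within /=.
rewrite (_ : (fun s => (g (f s) - g (f t)) / (s - t)) =
  (fun s => h (f s) * ((f s - f t) / (s - t)))); first exact: cvgM.
apply/funext => s; rewrite /h; case: eqVneq => [->|ne].
  by rewrite !subrr !mul0r mulr0.
by rewrite mulrA divfK // subr_eq0.
Unshelve. all: by end_near. Qed.

Lemma clamped_bounded (R : realType) (a b : R) (f : R -> R) : a < b ->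
  continuous f -> (forall t, f t = f (clamp a b t)) ->
  exists K, forall t, f t <= K.
Proof.
move=> ab cf fcl.
have [c _ fc] := EVT_max (ltW ab) (continuous_subspaceT cf).
by exists (f c) => t; rewrite fcl; apply: fc; rewrite in_itv /= clamp_itv.
Qed.

(** For e = 0 the pair (phi0, z phi0) would already solve the system. The defect e is absorbed by
    the correction (alpha, beta), which obeys a system with non-negative coefficients. *)
Lemma riccati_scalar_solution (R : realType) (a b : R) (sigma q d e z : R -> R) :
  a < b ->
  (forall t, a <= t <= b ->
    [/\ sigma s @[s --> within `[a, b] (nbhs t)] --> sigma t,
        q s @[s --> within `[a, b] (nbhs t)] --> q t &
        e s @[s --> within `[a, b] (nbhs t)] --> e t]) ->
  (forall t, a <= t <= b -> 0 <= q t /\ 0 <= e t) ->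
  (forall t, a <= t <= b -> has_deriv_within `[a, b] z t
    (- (q t * z t ^+ 2) - 2 * sigma t * z t - d t - e t)) ->
  exists phi psi, scalar_solution a b sigma q (fun t => - d t)
    (fun t => - sigma t) phi psi /\ forall t, a <= t <= b -> phi t != 0.
Proof.
move=> ab cts qe0 dz.
have cz t (tab : a <= t <= b) := cvg_dnbhs_nbhs (has_deriv_within_cvg (dz t tab)).
have csigma := clamp_extension ab (fun t tab => let: And3 h _ _ := cts t tab in h).
have cq := clamp_extension ab (fun t tab => let: And3 _ h _ := cts t tab in h).
have ce := clamp_extension ab (fun t tab => let: And3 _ _ h := cts t tab in h).
have {}cz := clamp_extension ab cz.
pose c := clamp a b.
pose k t := sigma (c t) + q (c t) * z (c t).
have ck : continuous k.
  move=> t; apply: cvgD; first exact: csigma.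
  by apply: cvgM; [exact: cq|exact: cz].
pose J := clamped_integral a b k.
pose phi0 t := expR (J t); pose eta t := expR (- J t).
have cJ : continuous J.
  by apply: clamped_integral_continuous => //; exact: continuous_integrable.
have cphi0 : continuous phi0.
  by move=> t; apply: continuous_comp; [exact: cJ|exact: continuous_expR].
have ceta : continuous eta.
  move=> t; apply: continuous_comp; last exact: continuous_expR.
  by apply: cvgN; exact: cJ.
have pe t : phi0 t * eta t = 1 by rewrite /phi0 /eta expRN divff ?gt_eqF ?expR_gt0.
have dJ t : a <= t <= b -> has_deriv_within `[a, b] J t (k t).
  exact: clamped_integral_deriv.
have dphi0 t : a <= t <= b -> has_deriv_within `[a, b] phi0 t (phi0 t * k t).
  by move=> tab; exact: has_deriv_within_comp (is_derive_expR _) (dJ t tab).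
have deta t : a <= t <= b -> has_deriv_within `[a, b] eta t (eta t * - k t).
  move=> tab; apply: (@has_deriv_within_comp _ _ (fun t => - J t) expR) => //.
  have := has_deriv_withinM (has_deriv_within_cst `[a, b] (-1) t) (dJ t tab).
  rewrite mul0r add0r mulN1r /has_deriv_within.
  by under eq_fun do rewrite !mulN1r.
pose Q t := q (c t) * (eta t * eta t).
pose E t := e (c t) * (phi0 t * phi0 t).
have cQ : continuous Q.
  move=> t; apply: cvgM; first exact: cq.
  by apply: cvgM; exact: ceta.
have cE : continuous E.
  move=> t; apply: cvgM; first exact: ce.
  by apply: cvgM; exact: cphi0.
have Q0 t : 0 <= Q t.
  by rewrite mulr_ge0 -?expr2 ?sqr_ge0 //; have [] := qe0 _ (clamp_itv ab t).
have E0 t : 0 <= E t.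
  by rewrite mulr_ge0 -?expr2 ?sqr_ge0 //; have [] := qe0 _ (clamp_itv ab t).
have cc t : c (c t) = c t by rewrite /c clamp_id // clamp_itv.
(* [Q] and [E] thus factor through the clamp, so their maxima on [[a, b]] bound them on the whole
   line. *)
have Jc t : J (c t) = J t.
  by rewrite /J /clamped_integral -[clamp a b (c t)]/(c (c t)) cc.
have [K1 QK] : exists K, forall t, Q t <= K.
  apply: (clamped_bounded ab cQ) => t.
  by rewrite -[clamp a b t]/(c t) /Q /eta Jc cc.
have [K2 EK] : exists K, forall t, E t <= K.
  apply: (clamped_bounded ab cE) => t.
  by rewrite -[clamp a b t]/(c t) /E /phi0 Jc cc.
have QK' t : Q t <= Num.max K1 K2 by rewrite le_max QK.
have EK' t : E t <= Num.max K1 K2 by rewrite le_max EK orbT.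
have [al [be [_ _ h]]] := positive_system ab cQ cE Q0 E0 QK' EK'.
exists (fun t => phi0 t * al t), (fun t => z t * (phi0 t * al t) + be t * eta t).
split=> t tab; last first.
  have [_ _ a1] := h t tab; rewrite mulf_neq0 ?gt_eqF ?expR_gt0 //.
  exact: lt_le_trans a1.
have [dal dbe _] := h t tab.
have ct : c t = t by exact: clamp_id.
have dphi := has_deriv_withinM (dphi0 t tab) dal.
split.
  (* Since phi0 eta = 1, the term phi0 Q beta collapses to q eta beta. *)
  suff -> : sigma t * (phi0 t * al t) + q t * (z t * (phi0 t * al t) + be t * eta t) =
    phi0 t * k t * al t + phi0 t * (Q t * be t) by [].
  by rewrite /k /Q ct; ring: (pe t).
have dpsi := has_deriv_withinD (has_deriv_withinM (dz t tab) dphi)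
  (has_deriv_withinM dbe (deta t tab)).
(* The contribution - e phi of z' phi is cancelled by beta' eta = e phi0 alpha, again through phi0
   eta = 1. *)
suff -> : - d t * (phi0 t * al t) + - sigma t *
    (z t * (phi0 t * al t) + be t * eta t) =
  (- (q t * z t ^+ 2) - 2 * sigma t * z t - d t - e t) * (phi0 t * al t) +
     z t * (phi0 t * k t * al t + phi0 t * (Q t * be t)) +
     (E t * al t * eta t + be t * (eta t * - k t)) by [].
by rewrite /k /Q /E ct; ring: (pe t).
Qed.

(** * Spectral estimates *)

Section Spectral.
Context {R : realType}.
Local Notation C := R[i].

(** [eigenvalue] refers to row vectors, and in A = P^-1 D P the rows of P are such eigenvectors,
    nonzero because P is invertible. *)
Lemma spectral_diag_eigenvalue n (A : 'M[C]_n) (i : 'I_n) :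
  A \is normalmx -> eigenvalue A (spectral_diag A 0 i).
Proof.
move=> /orthomx_spectralP Ae; set P := spectralmx A in Ae.
have uP : P \in unitmx := spectral_unit A.
apply/eigenvalueP; exists (row i P).
  rewrite {1}Ae -!row_mul !mulmxA mulmxV // mul1mx row_mul row_diag_mx.
  by rewrite -scalemxAl -rowE.
apply/eqP => r0; have : row i P *m invmx P = 0 by rewrite r0 mul0mx.
rewrite -row_mul mulmxV // => /rowP/(_ i)/eqP.
by rewrite !mxE eqxx /= oner_eq0.
Qed.

(** A unitary diagonalisation of [M] also diagonalises its adjoint, with conjugate entries. The two
    diagonals add up to twice the common real part, and a scalar matrix is unchanged by conjugation
    with P. *)
Lemma Omega_add_adjoint n (M : 'M[C]_n) : (0 < n)%N -> Omega M ->
  M + M^t* = (2 * W M)%:C%:M.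
Proof.
move=> n0 [Mn [r Mr]].
have MW : eigenvalues_have_Re M (W M) := xgetPex 0 (ex_intro _ r Mr).
have := Mn => /orthomx_spectralP Me; set P := spectralmx M in Me.
have uP : P \is unitarymx := spectral_unitarymx M.
rewrite invmx_unitary // in Me.
have Mse : M^t* = P^t* *m diag_mx (map_mx Num.conj (spectral_diag M)) *m P.
  rewrite {1}Me !trmx_mul !map_mxM /= trmxCK tr_diag_mx map_diag_mx mulmxA.
  by [].
have -> : M + M^t* = P^t* *m
    (diag_mx (spectral_diag M) + diag_mx (map_mx Num.conj (spectral_diag M))) *m P.
  by rewrite mulmxDr mulmxDl -Me -Mse.
rewrite -linearD /= (_ : _ + _ = const_mx (2 * W M)%:C).
  rewrite diag_const_mx -scalemx1 -scalemxAr mulmx1 -scalemxAl.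
  by rewrite -(invmx_unitary uP) mulVmx ?unitarymx_unit // scalemx1.
apply/rowP => i; rewrite !mxE.
have := MW _ (spectral_diag_eigenvalue i Mn).
rewrite -[Num.conj _]/(_^*)%C addcJ => ->.
by rewrite [RHS]rmorphM /= rmorph_nat.
Qed.

(** [W] is defined by choice, which says nothing about its dependence on the matrix; the trace
    formula is what makes [sigma_S] continuous. *)
Lemma Omega_tr n (M : 'M[C]_n) : (0 < n)%N -> Omega M ->
  W M = complex.Re (\tr M) / n%:R.
Proof.
move=> n0 OM; apply/(canRL (mulfK _)); first by rewrite pnatr_eq0 -lt0n.
have tE : \tr M + ((\tr M)^*)%C = (2 * W M)%:C *+ n.
  rewrite -mxtrace_scalar -Omega_add_adjoint // mxtraceD; congr (_ + _).
  by rewrite trace_map_mx mxtrace_tr.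
have := congr1 (@complex.Re R) tE.
rewrite addcJ raddfMn /= -mulr_natr => h; lra.
Qed.

(** In the coordinates w = v P^* of a unitary diagonalisation, both sides are sums over i of
    |w_i|^2, weighted by l and by the diagonal entries. *)
Lemma rayleigh_ge n (A : 'M[C]_n) (l : C) (v : 'rV[C]_n) : A \is normalmx ->
  (forall i, l <= spectral_diag A 0 i) ->
  l * (v *m v^t*) 0 0 <= (v *m A *m v^t*) 0 0.
Proof.
move=> /orthomx_spectralP Ae lA; set P := spectralmx A in Ae.
have uP : P \is unitarymx := spectral_unitarymx A.
rewrite invmx_unitary // in Ae; pose w := v *m P^t*.
have we : w^t* = P *m v^t* by rewrite /w trmx_mul map_mxM /= trmxCK.
have -> : v *m v^t* = w *m w^t*.
  rewrite we /w -mulmxA (mulmxA (P^t*)) -(invmx_unitary uP) mulVmx ?mul1mx //.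
  exact: unitarymx_unit.
have -> : v *m A *m v^t* = w *m diag_mx (spectral_diag A) *m w^t*.
  by rewrite we {1}Ae /w !mulmxA.
rewrite !mxE mulr_sumr; apply: ler_sum => i _.
rewrite mul_mx_diag !mxE mulrAC [leRHS]mulrC.
by apply: ler_wpM2r; [rewrite -normCK exprn_ge0|exact: lA].
Qed.

Lemma Re_le (x y : C) : x <= y -> complex.Re x <= complex.Re y.
Proof. by rewrite lecE => /andP[]. Qed.

(** The smallest spectral diagonal entry is a witness: it is an eigenvalue, and the Rayleigh bound
    at an eigenvector puts it below every real eigenvalue. The choice operator therefore does not
    fall back on its default. *)
Lemma least_eigenvalueP n (A : 'M[C]_n) : (0 < n)%N -> A \is hermsymmx ->
  is_least_eigenvalue A (least_eigenvalue A).
Proof.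
case: n A => // n A _ Ah; have An := hermitian_normalmx Ah.
have /mxOverP Ar := hermitian_spectral_diag_real Ah.
have ReE i : spectral_diag A 0 i = (complex.Re (spectral_diag A 0 i))%:C.
  by rewrite RRe_real.
apply: (@xgetPex _ 0 [set l | is_least_eigenvalue A l]).
pose i0 := [arg min_(i < ord0) complex.Re (spectral_diag A 0 i)]%O.
have i0P j : complex.Re (spectral_diag A 0 i0) <= complex.Re (spectral_diag A 0 j).
  by rewrite /i0; case: arg_minP => // i _; apply.
exists (complex.Re (spectral_diag A 0 i0)); split.
  by rewrite -ReE; exact: spectral_diag_eigenvalue.
move=> m /eigenvalueP[v vA v0].
have /rayleigh_ge : forall i,
    (complex.Re (spectral_diag A 0 i0))%:C <= spectral_diag A 0 i.
  by move=> i; rewrite [leRHS]ReE lecR.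
move=> /(_ v An); rewrite vA -scalemxAl [leRHS]mxE.
have vv : 0 < (v *m v^t*) 0 0 by rewrite -dotmxE dnorm_gt0.
by rewrite ler_pM2r // lecR.
Qed.

Lemma least_eigenvalue_rayleigh n (A : 'M[C]_n) (v : 'rV[C]_n) : (0 < n)%N ->
  A \is hermsymmx ->
  (least_eigenvalue A)%:C * (v *m v^t*) 0 0 <= (v *m A *m v^t*) 0 0.
Proof.
move=> n0 Ah; have An := hermitian_normalmx Ah.
have /mxOverP Ar := hermitian_spectral_diag_real Ah.
apply: rayleigh_ge => // i; rewrite -(RRe_real (Ar 0 i)) lecR.
have [_] := least_eigenvalueP n0 Ah; apply.
by rewrite RRe_real //; exact: spectral_diag_eigenvalue.
Qed.

Lemma least_eigenvalue_ge0 n (A : 'M[C]_n) : (0 < n)%N -> nonneg_definite A ->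
  0 <= least_eigenvalue A.
Proof.
move=> n0 [Ah A0]; have [/eigenvalueP[v vA v0] _] := least_eigenvalueP n0 Ah.
(* Eigenvectors are rows while definiteness tests columns, so the adjoint of [v] is inserted. *)
have := A0 (v^t*); rewrite trmxCK vA -scalemxAl [leRHS]mxE.
have vv : 0 < (v *m v^t*) 0 0 by rewrite -dotmxE dnorm_gt0.
by rewrite pmulr_lge0 // ler0c.
Qed.

(** Cauchy-Schwarz against the all-ones vector, from Lagrange's identity: the double sum of (x_i -
    x_j)^2 equals 2 (n T - S^2). *)
Lemma sum_sqr_le n (x : 'I_n -> R) :
  (\sum_i x i) ^+ 2 <= n%:R * \sum_i x i ^+ 2.
Proof.
have h : 0 <= \sum_i \sum_j (x i - x j) ^+ 2.
  by apply: sumr_ge0 => i _; apply: sumr_ge0 => j _; exact: sqr_ge0.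
pose S := \sum_i x i; pose T := \sum_i x i ^+ 2.
have inner i : \sum_j (x i - x j) ^+ 2 = x i ^+ 2 *+ n - x i * S *+ 2 + T.
  under eq_bigr do rewrite sqrrB.
  by rewrite big_split sumrB /= sumr_const card_ord sumrMnl mulr_sumr.
have E : \sum_i \sum_j (x i - x j) ^+ 2 = (n%:R * T - S ^+ 2) *+ 2.
  under eq_bigr do rewrite inner.
  rewrite big_split sumrB /= sumr_const card_ord !sumrMnl -mulr_suml -/S -/T.
  rewrite -(mulr_natl T); ring.
by move: h; rewrite E pmulrn_lge0 // subr_ge0.
Qed.

(** As [Z] is hermitian, the i-th diagonal entry of Z B Z is the form of [B] at row i of [Z], hence
    at least lambda(B) times the squared norm of that row. Since lambda(B) >= 0, only (Re Z_ii)^2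
    need be kept, and Cauchy-Schwarz on the diagonal produces the factor 1/n. *)
Lemma tr_sandwich_ge n (B Z : 'M[C]_n) : (0 < n)%N -> nonneg_definite B ->
  Z^t* = Z ->
  least_eigenvalue B / n%:R * complex.Re (\tr Z) ^+ 2 <=
    complex.Re (\tr (Z *m B *m Z)).
Proof.
move=> n0 B0 Zh; have [Bh _] := B0; have l0 := least_eigenvalue_ge0 n0 B0.
apply: (@le_trans _ _ (least_eigenvalue B * \sum_i complex.Re (Z i i) ^+ 2)).
  rewrite mulrAC -mulrA ler_wpM2l // ler_pdivrMr ?ltr0n // mulrC.
  by rewrite /mxtrace raddf_sum; exact: sum_sqr_le.
rewrite /mxtrace raddf_sum mulr_sumr; apply: ler_sum => i _.
have -> : (Z *m B *m Z) i i = (row i Z *m B *m (row i Z)^t*) 0 0.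
  transitivity ((Z *m B *m Z^t*) i i); first by rewrite Zh.
  rewrite -row_mul [LHS]mxE [RHS]mxE; apply: eq_bigr => j _.
  by rewrite [row i _ 0 j]mxE; congr (_ * _); rewrite !mxE.
have := Re_le (least_eigenvalue_rayleigh (row i Z) n0 Bh); apply: le_trans.
have -> : (row i Z *m (row i Z)^t*) 0 0 =
    (\sum_j (complex.Re (Z i j) ^+ 2 + complex.Im (Z i j) ^+ 2))%:C.
  rewrite mxE rmorph_sum /=; apply: eq_bigr => j _.
  by rewrite !mxE -normCK add_Re2_Im2.
rewrite -rmorphM /= ler_wpM2l // (bigD1 i) //= -addrA lerDl addr_ge0 ?sqr_ge0 //.
by apply: sumr_ge0 => j _; rewrite addr_ge0 ?sqr_ge0.
Qed.

Lemma normc_le (z : C) : `|z| <= (`|complex.Re z| + `|complex.Im z|)%:C.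
Proof.
rewrite normc_def lecR -[leRHS]ger0_norm ?addr_ge0 // -sqrtr_sqr.
rewrite ler_sqrt ?sqr_ge0 // sqrrD !real_normK ?num_real // -addrA lerD2l.
by rewrite lerDr mulrn_wge0 // mulr_ge0.
Qed.

(** Test [A] on an eigenvector v of [B]: the form of A - B at v is at most d |v|^2, because |v_i|
    |v_j| <= |v|^2 for all i, j. This yields the continuity of the least eigenvalue. *)
Lemma least_eigenvalue_lipschitz n (A B : 'M[C]_n) : (0 < n)%N ->
  A \is hermsymmx -> B \is hermsymmx ->
  least_eigenvalue A <= least_eigenvalue B + \sum_i \sum_j
    (`|complex.Re (A i j - B i j)| + `|complex.Im (A i j - B i j)|).
Proof.
move=> n0 Ah Bh; set d := \sum_i _.
have [/eigenvalueP[v vB v0] _] := least_eigenvalueP n0 Bh.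
have vv : 0 < (v *m v^t*) 0 0 by rewrite -dotmxE dnorm_gt0.
have vvE : (v *m v^t*) 0 0 = \sum_i `|v 0 i| ^+ 2.
  by rewrite mxE; apply: eq_bigr => i _; rewrite !mxE -normCK.
have vle i : `|v 0 i| ^+ 2 <= (v *m v^t*) 0 0.
  by rewrite vvE (bigD1 i) //= lerDl sumr_ge0 // => j _; rewrite exprn_ge0.
have vle2 i j : `|v 0 i| * `|v 0 j| <= (v *m v^t*) 0 0.
  have /orP[ij|ij] := real_leVge (normr_real (v 0 i)) (normr_real (v 0 j)).
    by apply: le_trans (vle j); rewrite expr2 ler_wpM2r.
  by apply: le_trans (vle i); rewrite expr2 ler_wpM2l.
have dle : `|(v *m (A - B) *m v^t*) 0 0| <= d%:C * (v *m v^t*) 0 0.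
  rewrite -mulmxA mxE rmorph_sum /= mulr_suml.
  apply: le_trans (ler_norm_sum _ _ _) _; apply: ler_sum => i _.
  rewrite normrM mxE rmorph_sum /= mulr_suml.
  apply: le_trans (ler_wpM2l (normr_ge0 _) (ler_norm_sum _ _ _)) _.
  rewrite mulr_sumr; apply: ler_sum => j _.
  rewrite !mxE normrM norm_conjC mulrCA.
  apply: ler_pM => //; first exact: normc_le.
  by have := vle2 i j; rewrite mxE.
have := least_eigenvalue_rayleigh v n0 Ah.
have -> : (v *m A *m v^t*) 0 0 = (v *m (A - B) *m v^t*) 0 0 +
    (least_eigenvalue B)%:C * (v *m v^t*) 0 0.
  by rewrite -[in LHS](subrK B A) mulmxDr mulmxDl vB -scalemxAl mxE [X in _ + X]mxE.
move=> h; rewrite -lecR -(ler_pM2r vv) rmorphD /= mulrDl addrC.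
apply: (le_trans h); rewrite lerD2r; apply: le_trans dle.
(* A complex number lies below its modulus only if it is real; here realness follows from
   comparability in [h]. *)
apply: real_ler_norm; move: h; rewrite -lerBlDr => /ler_real <-.
by rewrite -mulrBl -rmorphB /= realM // ?complex_real // gtr0_real.
Qed.

End Spectral.

(** * The matrix Riccati equation *)

Section MatrixDeriv.
Context {R : realType} {n : nat}.
Local Notation C := R[i].
Implicit Types (D : set R) (F : R -> 'M[C]_n) (L : 'M[C]_n) (t : R).

Lemma mxcvg_sub (G H : set_system R) {FG : Filter G} {FH : Filter H} F L :
  H --> G -> mxcvg G F L -> mxcvg H F L.
Proof.
move=> HG GF i j; have [FRe FIm] := GF i j.
by split; [apply: cvg_trans FRe|apply: cvg_trans FIm]; exact: cvg_fmap2.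
Qed.

Lemma within_subfilter (A B : set R) (G : set_system R) : Filter G ->
  A `<=` B -> within A G --> within B G.
Proof.
move=> FG AB P BP; have {}BP : G (fun x => B x -> P x) := BP.
suff : G (fun x => A x -> P x) by [].
by apply: filterS BP => x h /AB.
Qed.

(** The quotient of [mx_has_deriv_within], named so that derivatives can be expressed by [mxcvg]
    rather than by the matrix topology. *)
Definition mx_quotient F t s := ((s - t)^-1)%:C *: (F s - F t).

Lemma mx_quotient_ReIm F t s i j :
  complex.Re (mx_quotient F t s i j) =
    (complex.Re (F s i j) - complex.Re (F t i j)) / (s - t) /\
  complex.Im (mx_quotient F t s i j) =
    (complex.Im (F s i j) - complex.Im (F t i j)) / (s - t).
Proof.
rewrite !mxE; case: (F s i j) (F t i j) => x1 x2 [y1 y2] /=.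
by rewrite !mul0r subr0 addr0; split; rewrite mulrC.
Qed.

Lemma mx_quotient_cvg D F t L :
  mxcvg (within D t^') (mx_quotient F t) L -> mxcvg (within D t^') F (F t).
Proof.
move=> FL i j; have [FRe FIm] := FL i j; split.
  apply: (@has_deriv_within_cvg _ _ (fun s => complex.Re (F s i j)) _
    (complex.Re (L i j))).
  rewrite /has_deriv_within; apply: cvg_trans FRe; apply: near_eq_cvg.
  by apply: nearW => s; have [-> _] := mx_quotient_ReIm F t s i j.
apply: (@has_deriv_within_cvg _ _ (fun s => complex.Im (F s i j)) _
  (complex.Im (L i j))).
rewrite /has_deriv_within; apply: cvg_trans FIm; apply: near_eq_cvg.
by apply: nearW => s; have [_ ->] := mx_quotient_ReIm F t s i j.
Qed.

Lemma mxcvg_dnbhs_nbhs D F t :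
  mxcvg (within D t^') F (F t) -> mxcvg (within D (nbhs t)) F (F t).
Proof.
move=> FL i j; have [FRe FIm] := FL i j.
split; first exact: (@cvg_dnbhs_nbhs _ _ (fun s => complex.Re (F s i j))).
exact: (@cvg_dnbhs_nbhs _ _ (fun s => complex.Im (F s i j))).
Qed.

Lemma Re_tr_deriv D F t L : mxcvg (within D t^') (mx_quotient F t) L ->
  has_deriv_within D (fun s => complex.Re (\tr (F s))) t (complex.Re (\tr L)).
Proof.
move=> FL; have [FRe _] := ccvg_tr FL.
rewrite /has_deriv_within; apply: cvg_trans FRe; apply: near_eq_cvg.
apply: nearW => s; rewrite mxtraceZ raddfB /=.
case: (\tr (F s)) (\tr (F t)) => x1 x2 [y1 y2] /=.
by rewrite mul0r subr0 mulrC.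
Qed.

Lemma mx_deriv_quotient_cvg D D' F t L : D `<=` D' ->
  mx_has_deriv_within D' F t L -> mxcvg (within D t^') (mx_quotient F t) L.
Proof.
move=> DD' FL.
have h : mxcvg (within D' t^') (mx_quotient F t) L by exact: cvg_mxcvg FL.
by apply: (mxcvg_sub _ h); exact: within_subfilter.
Qed.

Lemma mx_continuous_on_cvg D D' F t : D `<=` D' -> D' t ->
  mx_continuous_on D' F -> mxcvg (within D (nbhs t)) F (F t).
Proof.
move=> DD' Dt /subspace_continuousP /(_ t Dt) h.
by apply: (mxcvg_sub _ (cvg_mxcvg h)); exact: within_subfilter.
Qed.

Lemma least_eigenvalue_cvg (G : set_system R) {FG : Filter G} F L :
  (0 < n)%N -> L \is hermsymmx -> (\forall s \near G, F s \is hermsymmx) ->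
  mxcvg G F L -> least_eigenvalue (F s) @[s --> G] --> least_eigenvalue L.
Proof.
move=> n0 Lh Fh FL.
pose d s := \sum_i \sum_j
    (`|complex.Re (F s i j - L i j)| + `|complex.Im (F s i j - L i j)|).
have d0 : d s @[s --> G] --> (0 : R).
  have -> : 0 = \sum_(i < n) \sum_(j < n) (0 + 0 : R).
    by rewrite big1 // => i _; rewrite big1 // => j _; rewrite addr0.
  apply: cvg_big => [|i _]; first exact: add_continuous.
  apply: cvg_big => [|j _]; first exact: add_continuous.
  have [FRe FIm] := FL i j.
  apply: cvgD; apply/norm_cvg0P.
    rewrite -(subrr (complex.Re (L i j))); under eq_fun do rewrite raddfB.
    by apply: cvgB => //; exact: cvg_cst.
  rewrite -(subrr (complex.Im (L i j))); under eq_fun do rewrite raddfB.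
  by apply: cvgB => //; exact: cvg_cst.
(* The Lipschitz bound is used in both directions, with the two matrices exchanged for the lower
   estimate. *)
apply: (@squeeze_cvgr _ _ _ _ (fun s => least_eigenvalue L - d s)
  (fun s => least_eigenvalue L + d s)).
- apply: filterS Fh => s Fsh; apply/andP; split; last exact: least_eigenvalue_lipschitz.
  rewrite lerBlDr; have := least_eigenvalue_lipschitz n0 Lh Fsh.
  congr (_ <= _ + _); apply: eq_bigr => i _; apply: eq_bigr => j _.
  by rewrite -opprB !raddfN !normrN.
- rewrite -[X in _ --> X]subr0; apply: cvgB => //; exact: cvg_cst.
- rewrite -[X in _ --> X]addr0; apply: cvgD => //; exact: cvg_cst.
Qed.

End MatrixDeriv.

(** * Riccati equation of Psi Phi^-1 and its trace *)

Lemma hermsymmx_adjoint (R : realType) n (A : 'M[R[i]]_n) :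
  A \is hermsymmx -> A^t* = A.
Proof. by move=> /is_hermitianmxP Ah; rewrite [RHS]Ah expr0 scale1r. Qed.

(** [N] stands for the adjoint of [A]. After substituting Y = Z + S, cyclicity of the trace moves A
    and B S to the left of Z, so that M and its adjoint appear together; the terms free of Z form -
    tr D_S. *)
Lemma trace_riccati_shift (F : comNzRingType) n (N A B C S dS Z : 'M[F]_n) :
  let Y := Z + S in
  \tr (C - N *m Y - Y *m A - Y *m B *m Y - dS) =
  - \tr (Z *m B *m Z) - \tr ((N + S *m B + (A + B *m S)) *m Z) -
  \tr (dS + S *m B *m S + N *m S + S *m A - C).
Proof.
move=> Y.
have trB (X1 X2 : 'M[F]_n) : \tr (X1 - X2) = \tr X1 - \tr X2 := raddfB _ X1 X2.
have c1 : \tr (A *m Z) = \tr (Z *m A) by exact: mxtrace_mulC.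
have c2 : \tr (B *m S *m Z) = \tr (Z *m B *m S) by rewrite mxtrace_mulC mulmxA.
rewrite /Y !(mulmxDl, mulmxDr) !trB !mxtraceD c1 c2.
ring.
Qed.

(** Membership in [Omega] makes M plus its adjoint scalar, so the linear term depends on Z through
    its trace alone: this is what closes the equation for tr Z. *)
Lemma trace_riccati (R : realType) n (A B C S dS Z : 'M[R[i]]_n) :
  (0 < n)%N -> B^t* = B -> S^t* = S -> Omega (A^t* + S *m B) ->
  let Y := Z + S in
  complex.Re (\tr (C - A^t* *m Y - Y *m A - Y *m B *m Y - dS)) =
  - complex.Re (\tr (Z *m B *m Z)) - 2 * W (A^t* + S *m B) * complex.Re (\tr Z)
  - complex.Re (\tr (dS + S *m B *m S + A^t* *m S + S *m A - C)).
Proof.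
move=> n0 Bh Sh OM Y.
have Madj : (A^t* + S *m B)^t* = A + B *m S.
  by rewrite linearD /= trmx_mul map_mxD map_mxM /= trmxCK Bh Sh.
have tZ : \tr ((A^t* + S *m B + (A + B *m S)) *m Z) =
    (2 * W (A^t* + S *m B))%:C * \tr Z.
  by rewrite -Madj Omega_add_adjoint // mul_scalar_mx mxtraceZ.
rewrite trace_riccati_shift tZ.
case: (\tr _) => z1 z2; case: (\tr _) => t1 t2.
by case: (\tr _) => d1 d2 /=; rewrite mul0r subr0.
Qed.

(** The quotient of Y equals exactly (quotient of Psi - Y t times quotient of Phi) times the inverse
    of [Phi s]. Only continuity of the inverse is then used, not its derivative. *)
Lemma riccati_quotient_cvg (R : realType) n (D : set R) (t : R)
    (Phi Psi : R -> 'M[R[i]]_n) (A B C : 'M[R[i]]_n) :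
  D t -> (forall s, D s -> Phi s \in unitmx) ->
  mxcvg (within D t^') (mx_quotient Phi t) (A *m Phi t + B *m Psi t) ->
  mxcvg (within D t^') (mx_quotient Psi t) (C *m Phi t - A^t* *m Psi t) ->
  let Y s := Psi s *m invmx (Phi s) in
  mxcvg (within D t^') (mx_quotient Y t)
    (C - A^t* *m Y t - Y t *m A - Y t *m B *m Y t).
Proof.
move=> Dt uPhi dPhi dPsi Y.
have cPhi := mx_quotient_cvg dPhi.
have uD : \forall s \near within D t^', Phi s \in unitmx.
  by apply: filterS (@near_withinT _ t^' D _) => s; exact: uPhi.
have -> : C - A^t* *m Y t - Y t *m A - Y t *m B *m Y t =
    ((C *m Phi t - A^t* *m Psi t) - Y t *m (A *m Phi t + B *m Psi t)) *m
      invmx (Phi t).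
  rewrite mulmxDr !mulmxBl mulmxDl -!mulmxA mulmxV ?uPhi // -/(Y t) !mulmx1.
  by rewrite opprD !addrA.
apply: near_mxcvg (mxcvgM (mxcvgB dPsi (mxcvgM (mxcvg_cst (Y t)) dPhi))
  (mxcvgV (uPhi t Dt) uD cPhi)).
apply: filterS uD => s us; rewrite /mx_quotient -scalemxAr -scalerBr -scalemxAl.
congr (_ *: _); rewrite !mulmxBl mulmxBr mulmxBl /Y -!mulmxA mulmxV // mulKmx ?uPhi //.
by rewrite mulmx1 opprB addrA subrK.
Qed.

(** * Contradiction from a non-singular prepared solution *)

Theorem theorem2p1 (R : realType) (n : nat) (n_gt0 : (0 < n)%N)
    (t0 a b : R) (A B C : R -> 'M[R[i]]_n)
    (hA : mx_continuous_on `[t0, +oo[ A)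
    (hB : mx_continuous_on `[t0, +oo[ B)
    (hC : mx_continuous_on `[t0, +oo[ C)
    (hBherm : forall t : R, t0 <= t -> B t \is hermsymmx)
    (hCherm : forall t : R, t0 <= t -> C t \is hermsymmx)
    (ht0a : t0 <= a) (hab : a < b)
    (hBnonneg : forall t : R, a <= t <= b -> nonneg_definite (B t))
    (S dS : R -> 'M[R[i]]_n)
    (hSC1 : mx_C1_deriv `[a, b] S dS)
    (hSherm : forall t : R, a <= t <= b -> S t \is hermsymmx)
    (hSOmega : forall t : R, a <= t <= b -> Omega ((A t)^t* + S t *m B t))
    (hosc : scalar_oscillatory a b
      (sigma_S A B S)
      (fun t => least_eigenvalue (B t) / n%:R)
      (* the matrix D_S is hermitian, so its trace is real *)
      (fun t => - complex.Re (\tr (D_S A B C S dS t)))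
      (fun t => - sigma_S A B S t)) :
  hamiltonian_oscillatory t0 A B C a b.
Proof.
move=> Phi Psi [[dPhi _] [dPsi _]] prep; apply: contrapT => nosc.
have sub : `[a, b] `<=` `[t0, +oo[.
  by move=> t; rewrite /= !in_itv /= andbT => /andP[/(le_trans ht0a)].
have itvE t : a <= t <= b -> (`[a, b]%classic t) by rewrite /= in_itv.
have ge_t0 t : a <= t <= b -> t0 <= t by case/andP => /(le_trans ht0a).
have uPhi t : `[a, b]%classic t -> Phi t \in unitmx.
  rewrite /= in_itv /= => tab; rewrite unitmxE unitfE; apply/eqP => d0.
  by apply: nosc; exists t.
pose Y t := Psi t *m invmx (Phi t).
pose Z t := Y t - S t.
have YSE t : Z t + S t = Y t by rewrite subrK.
have Yh t : a <= t <= b -> (Y t)^t* = Y t.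
  move=> tab; have uP := uPhi t (itvE t tab).
  have uP' : (Phi t)^t* \in unitmx by rewrite map_unitmx unitmx_tr.
  rewrite /Y trmx_mul map_mxM /= trmx_inv map_invmx.
  (* Multiplying by Phi Phi^-1 on the right exposes Psi^* Phi, which preparedness replaces by Phi^*
     Psi. *)
  rewrite -[LHS](mulmxK uP) -(mulmxA _ _ (Phi t)) -prep ?ge_t0 //.
  by rewrite mulKmx.
have Bh t : a <= t <= b -> (B t)^t* = B t.
  by move=> tab; apply: hermsymmx_adjoint; apply: hBherm; exact: ge_t0.
have Sh t : a <= t <= b -> (S t)^t* = S t.
  by move=> tab; apply: hermsymmx_adjoint; exact: hSherm.
have Zh t : a <= t <= b -> (Z t)^t* = Z t.
  by move=> tab; rewrite /Z linearB /= map_mxB -/(_^t*) Yh // Sh.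
have dS' t : a <= t <= b -> mxcvg (within `[a, b] t^') (mx_quotient S t) (dS t).
  by move=> tab; apply: mx_deriv_quotient_cvg (hSC1.1 t (itvE t tab)).
have dZ t : a <= t <= b -> mxcvg (within `[a, b] t^') (mx_quotient Z t)
    (C t - (A t)^t* *m Y t - Y t *m A t - Y t *m B t *m Y t - dS t).
  move=> tab; have Dt := sub _ (itvE t tab).
  have dY : mxcvg (within `[a, b] t^') (mx_quotient Y t)
      (C t - (A t)^t* *m Y t - Y t *m A t - Y t *m B t *m Y t).
    apply: riccati_quotient_cvg (itvE t tab) uPhi _ _.
      exact: mx_deriv_quotient_cvg sub (dPhi t Dt).
    exact: mx_deriv_quotient_cvg sub (dPsi t Dt).
  apply: near_mxcvg (mxcvgB dY (dS' t tab)); apply: nearW => s.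
  by rewrite /mx_quotient -scalerBr /Z; congr (_ *: _); rewrite !opprD !opprK addrACA.
have cZ t (tab : a <= t <= b) := mxcvg_dnbhs_nbhs (mx_quotient_cvg (dZ t tab)).
have cS t (tab : a <= t <= b) := mxcvg_dnbhs_nbhs (mx_quotient_cvg (dS' t tab)).
have cA t (tab : a <= t <= b) := mx_continuous_on_cvg sub (sub _ (itvE t tab)) hA.
have cB t (tab : a <= t <= b) := mx_continuous_on_cvg sub (sub _ (itvE t tab)) hB.
have near_itv (t : R) : \forall s \near within `[a, b] (nbhs t), a <= s <= b.
  by rewrite near_withinE; apply: nearW => s; rewrite /= in_itv.
pose q t := least_eigenvalue (B t) / n%:R.
pose z t := complex.Re (\tr (Z t)).
(* The defect in the trace inequality for Z B Z; restoring it turns the inequality for z into an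
   equation. *)
pose e t := complex.Re (\tr (Z t *m B t *m Z t)) - q t * z t ^+ 2.
have cq t : a <= t <= b -> q s @[s --> within `[a, b] (nbhs t)] --> q t.
  move=> tab; apply: cvgM; last exact: cvg_cst.
  apply: least_eigenvalue_cvg (cB t tab) => //; first by apply: hBherm; exact: ge_t0.
  by apply: filterS (near_itv t) => s sab; apply: hBherm; exact: ge_t0.
have csigma t : a <= t <= b ->
    sigma_S A B S s @[s --> within `[a, b] (nbhs t)] --> sigma_S A B S t.
  move=> tab; have [cM _] := ccvg_tr (mxcvgD (mxcvg_conj (cA t tab))
    (mxcvgM (cS t tab) (cB t tab))).
  rewrite /sigma_S Omega_tr //; last exact: hSOmega.
  have : complex.Re (\tr ((A s)^t* + S s *m B s)) / n%:R
      @[s --> within `[a, b] (nbhs t)] -->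
      complex.Re (\tr ((A t)^t* + S t *m B t)) / n%:R.
    by apply: cvgM => //; exact: cvg_cst.
  apply: cvg_trans; apply: near_eq_cvg; apply: filterS (near_itv t) => s sab.
  by rewrite Omega_tr //; exact: hSOmega.
have ce t : a <= t <= b -> e s @[s --> within `[a, b] (nbhs t)] --> e t.
  move=> tab; have [cz _] := ccvg_tr (cZ t tab).
  have [cZBZ _] := ccvg_tr (mxcvgM (mxcvgM (cZ t tab) (cB t tab)) (cZ t tab)).
  apply: cvgB => //; apply: cvgM; first exact: cq.
  by apply: cvgM.
have qe0 t : a <= t <= b -> 0 <= q t /\ 0 <= e t.
  move=> tab; split.
    by rewrite divr_ge0 // least_eigenvalue_ge0 //; exact: hBnonneg.
  by rewrite subr_ge0; apply: tr_sandwich_ge => //; [exact: hBnonneg|exact: Zh].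
have dz t : a <= t <= b -> has_deriv_within `[a, b] z t
    (- (q t * z t ^+ 2) - 2 * sigma_S A B S t * z t -
     complex.Re (\tr (D_S A B C S dS t)) - e t).
  move=> tab; have := Re_tr_deriv (dZ t tab).
  rewrite -YSE trace_riccati //; [|exact: Bh|exact: Sh|exact: hSOmega].
  rewrite -/(sigma_S A B S t) -/(D_S A B C S dS t) -/(z t).
  suff -> : - complex.Re (\tr (Z t *m B t *m Z t)) = - (q t * z t ^+ 2) - e t.
    by congr has_deriv_within; ring.
  by rewrite /e; ring.
have [phi [psi [sol phi0]]] := riccati_scalar_solution hab
  (fun t tab => And3 (csigma t tab) (cq t tab) (ce t tab)) qe0 dz.
by have [t tab /eqP] := hosc phi psi sol; apply/negP; exact: phi0.
Qed.
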